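(* For all integers $m \geqslant 2$ and $n \geqslant 3$, $r(I_m, L_n) \leqslant v(m,n)$, where \[ v(m,n) = \sum_{i=0}^{n-2} \binom{i+m-1}{i+1} 2^i - \binom{m+n-6}{m-4} 2^{n-3} + 1. \]
   Context: An oriented graph is a finite directed graph with no loops in which each pair of distinct vertices is joined by at most one arc. $r(I_m, L_n)$ is the least natural number $k$ such that every oriented graph on $k$ vertices contains either an independent set of size $m$ or a set of $n$ vertices inducing a transitive tournament. Binomial coefficients $\binom{a}{b}$ with $b < 0$ are taken to be $0$. *)

(* Defs.v *)
From HB Require Import structures.
From mathcomp Require Import all_boot all_order all_algebra.
Set Implicit Arguments.
Unset Strict Implicit.
Unset Printing Implicit Defensive.
Import Order.TTheory GRing.Theory Num.Theory.
Local Open Scope ring_scope.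

Section OrientedGraphs.
Variables (T : finType) (e : rel T).
Implicit Type S : {set T}.

(* e x y means that there is an arc from x to y. *)
Definition oriented : Prop :=
  (forall x, ~~ e x x) /\ (forall x y, x != y -> ~~ (e x y && e y x)).

Definition independent S : Prop :=
  forall x y, x \in S -> y \in S -> ~~ e x y.

Definition tournament_on S : Prop :=
  forall x y, x \in S -> y \in S -> x != y -> e x y (+) e y x.

Definition transitive_on S : Prop :=
  forall x y z, x \in S -> y \in S -> z \in S -> e x y -> e y z -> e x z.

Definition induces_transitive_tournament S : Prop :=
  tournament_on S /\ transitive_on S.

End OrientedGraphs.

Definition ramsey_property (m n k : nat) : Prop :=
  forall (T : finType) (e : rel T), #|T| = k -> oriented e ->
    (exists S : {set T}, #|S| = m /\ independent e S) \/
    (exists S : {set T}, #|S| = n /\ induces_transitive_tournament e S).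

(* r = r(I_m, L_n) *)
Definition is_ramsey_number (m n r : nat) : Prop :=
  ramsey_property m n r /\
  forall k : nat, ramsey_property m n k -> (r <= k)%N.

(* The integer binomial coefficient, 0 when b < 0; for a = - (p + 1) < 0 <= b
   it is a (a - 1) ... (a - b + 1) / b! = (-1)^b 'C(p + b, b). *)
Definition binz (a b : int) : int :=
  match b, a with
  | Negz _, _ => 0
  | Posz k, Posz p => ('C(p, k))%:Z
  | Posz k, Negz p => (-1) ^+ k * ('C(p + k, k))%:Z
  end.

(* Integer-valued because of the subtracted binomial term; the truncated
   n.-1 and n - 3 are exact for n >= 3. *)
Definition v (m n : nat) : int :=
  \sum_(0 <= i < n.-1) binz (i%:Z + m%:Z - 1) (i%:Z + 1) * 2 ^+ i
  - binz (m%:Z + n%:Z - 6) (m%:Z - 4) * 2 ^+ (n - 3) + 1.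

(* Main.v *)
(** Write k = m - 1 and l = n - 1, so that independent sets have at most k and
    transitive tournaments at most l vertices. Splitting a vertex set into a
    vertex x, its out-neighbours, its in-neighbours and its non-neighbours gives
    the recursion f(k, l) <= 1 + 2 f(k, l - 1) + f(k - 1, l), which v - 1
    satisfies with equality, and reduces everything to l = 2, where the claim for k >= 2
    is f(k, 2) <= k^2 + k + 2.

    For l = 2 in- and out-neighbourhoods are independent. If S had
    k^2 + k + 3 vertices, k >= 3, then by induction every in- and
    out-neighbourhood has exactly k vertices, and the set C of non-neighbours
    of x has k^2 - k + 2. Let A be a maximum independent set. Each vertex
    outside A has a neighbour in A, and at most 2k have only one: two
    non-adjacent vertices whose only neighbour in A is a could replace a.
    Applied to both neighbourhoods of x, this bounds the degree sum inside C by
    (2k - 4)|C| + 4k. Induction applied to C bounds degrees inside C from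
    below, by 2k - 3 for k >= 4 and by 4 for k = 3; this is contradictory
    except for k = 4. In that case |C| = 14 and the degree sum is at most 72, so
    some c in C has degree 5 in C, and counting the edges between its
    neighbours and its non-neighbours in C gives a contradiction. *)

Require Import Defs.
From HB Require Import structures.
From Stdlib Require Import Classical.
From mathcomp Require Import all_boot all_order all_algebra zify.
Set Implicit Arguments.
Unset Strict Implicit.
Unset Printing Implicit Defensive.
Import Order.TTheory GRing.Theory Num.Theory.

(** * Underlying graph: independence bounds and edge counts *)

Section Adjacency.
Variables (T : finType) (e : rel T).
Hypothesis eirr : forall x, ~~ e x x.
Implicit Types (x y z : T) (S A X Y Z : {set T}).

Definition adj x y := e x y || e y x.
Definition nbh x : {set T} := [set y | adj x y].
Definition onbh x : {set T} := [set y | e x y].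
Definition inbh x : {set T} := [set y | e y x].
Definition alpha_le k S :=
  forall A, A \subset S -> independent e A -> #|A| <= k.
(** This counts ordered pairs, so [edges X X] is the degree sum inside [X], with each edge taken
    twice. *)
Definition edges X Y := \sum_(x in X) #|Y :&: nbh x|.

Lemma adjC x y : adj x y = adj y x.
Proof. by rewrite /adj orbC. Qed.

Lemma adjxx x : adj x x = false.
Proof. by rewrite /adj orbb (negbTE (eirr x)). Qed.

Lemma nbhE x : nbh x = onbh x :|: inbh x.
Proof. by apply/setP=> y; rewrite !inE. Qed.

Lemma independentP A :
  independent e A <-> forall x y, x \in A -> y \in A -> ~~ adj x y.
Proof.
split=> iA x y Ax Ay; first by rewrite negb_or !iA.
by have := iA _ _ Ax Ay; rewrite negb_or => /andP[].
Qed.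

Lemma independent_sub A X : A \subset X -> independent e X -> independent e A.
Proof. by move=> /subsetP sAX iX x y /sAX Xx /sAX Xy; exact: iX. Qed.

Arguments independent_sub [A X] _ _ x y.

Lemma independent1 x : independent e [set x].
Proof. by move=> y z /set1P-> /set1P->. Qed.

Lemma independentU1 x A :
  independent e A -> A :&: nbh x = set0 -> independent e (x |: A).
Proof.
move=> /independentP iA /setP A0; apply/independentP=> y z.
have xA w : w \in A -> ~~ adj x w.
  by move=> Aw; have := A0 w; rewrite !inE Aw /= => ->.
case/setU1P=> [->|Ay] /setU1P[->|Az].
- by rewrite adjxx.
- exact: xA.
- by rewrite adjC xA.
- exact: iA.
Qed.

Arguments independentU1 [x A] _ _ x y.

Lemma alpha_le_sub k S X : X \subset S -> alpha_le k S -> alpha_le k X.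
Proof. by move=> sXS aS A sAX; apply: aS; exact: subset_trans sXS. Qed.

Lemma alpha_le_nonnbh k S x :
  x \in S -> alpha_le k.+1 S -> alpha_le k (S :\ x :\: nbh x).
Proof.
move=> Sx aS A sA iA; have /subsetP sA' := sA.
have xA : x \notin A by apply/negP=> /sA'; rewrite !inE eqxx andbF.
rewrite -ltnS -add1n -[1]/(true : nat) -xA -cardsU1; apply: aS.
  rewrite subUset sub1set Sx; apply: subset_trans sA _.
  exact: subset_trans (subsetDl _ _) (subsetDl _ _).
apply: independentU1 => //; apply/setP=> y; rewrite !inE.
by apply/negP=> /andP[/sA']; rewrite !inE => /andP[/negP].
Qed.

Lemma card_nbh_split S x : x \in S ->
  #|S| = (#|S :&: nbh x| + #|S :\ x :\: nbh x|).+1.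
Proof.
move=> Sx; rewrite (cardsD1 x) Sx add1n -(cardsID (nbh x)); congr (_ + _).+1.
by apply: eq_card => y; rewrite !inE; case: eqP => //= ->; rewrite adjxx andbF.
Qed.

Lemma edgesC X Y : edges X Y = edges Y X.
Proof.
have E Z x : #|Z :&: nbh x| = \sum_(y in Z) adj x y.
  rewrite -sum1_card big_mkcond [RHS]big_mkcond; apply: eq_bigr => y _.
  by rewrite !inE; case: (y \in Z); case: (adj x y).
rewrite /edges; under eq_bigr do rewrite E.
rewrite exchange_big; apply: eq_bigr => y _; rewrite E.
by apply: eq_bigr => x _; rewrite adjC.
Qed.

Lemma edgesUr X Y Z : [disjoint Y & Z] ->
  edges X (Y :|: Z) = edges X Y + edges X Z.
Proof.
move=> dYZ; rewrite -big_split; apply: eq_bigr => x _.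
by rewrite setIUl cardsU setIACA (disjoint_setI0 dYZ) set0I cards0 subn0.
Qed.

Lemma edgesUl X Y Z : [disjoint Y & Z] ->
  edges (Y :|: Z) X = edges Y X + edges Z X.
Proof. by move=> dYZ; rewrite edgesC edgesUr // !(edgesC X). Qed.

Lemma edges1l x X : edges [set x] X = #|X :&: nbh x|.
Proof. by rewrite /edges big_set1. Qed.

Lemma edges_ge k X Y : (forall x, x \in X -> k <= #|Y :&: nbh x|) ->
  #|X| * k <= edges X Y.
Proof. by move=> H; rewrite -sum_nat_const; apply: leq_sum. Qed.

Lemma edges_indep A : independent e A -> edges A A = 0.
Proof.
move=> /independentP iA; apply: big1 => x Ax; apply: eq_card0 => y.
by rewrite !inE; apply/negP=> /andP[Ay]; apply/negP/iA.
Qed.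

Lemma nbh_max_indep k S A x : alpha_le k S -> A \subset S ->
  independent e A -> #|A| = k -> x \in S :\: A -> 0 < #|A :&: nbh x|.
Proof.
move=> aS sAS iA cA /setDP[Sx xA]; rewrite lt0n cards_eq0; apply/eqP=> A0.
have := aS (x |: A); rewrite subUset sub1set Sx sAS cardsU1 xA cA add1n ltnn.
by move=> H; move: (H isT (independentU1 iA A0)).
Qed.

(** * Graphs without transitive triangles: the case l = 2 *)

Section TriangleFree.
Hypothesis noL3 : forall x y z, e x y -> e y z -> ~~ e x z.

Lemma onbh_indep x : independent e (onbh x).
Proof.
by move=> y z; rewrite !inE => exy exz; apply/negP=> /(noL3 exy); rewrite exz.
Qed.

Lemma inbh_indep x : independent e (inbh x).
Proof.
move=> y z; rewrite !inE => eyx ezx; apply/negP=> /noL3 /(_ ezx).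
by rewrite eyx.
Qed.

Arguments onbh_indep : clear implicits.
Arguments inbh_indep : clear implicits.

Lemma card_onbh_le k S x : alpha_le k S -> #|S :&: onbh x| <= k.
Proof.
move=> aS; apply: aS (subsetIl _ _) _.
exact: independent_sub (subsetIr _ _) (onbh_indep x).
Qed.

Lemma card_inbh_le k S x : alpha_le k S -> #|S :&: inbh x| <= k.
Proof.
move=> aS; apply: aS (subsetIl _ _) _.
exact: independent_sub (subsetIr _ _) (inbh_indep x).
Qed.

Lemma card_nbh_le2 S x :
  #|S :&: nbh x| <= #|S :&: onbh x| + #|S :&: inbh x|.
Proof. by rewrite nbhE setIUr cardsU leq_subr. Qed.

Lemma card_nbh_le k S x : alpha_le k S -> #|S :&: nbh x| <= k.*2.
Proof.
move=> aS; rewrite -addnn (leq_trans (card_nbh_le2 _ _)) // leq_add //.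
  exact: card_onbh_le.
exact: card_inbh_le.
Qed.

(* Two non-adjacent vertices whose only neighbour in A is a could replace a. *)
Lemma private_le1 k S A X a : alpha_le k S -> A \subset S ->
  independent e A -> #|A| = k -> a \in A -> independent e X ->
  X \subset S :\: A -> (forall x, x \in X -> A :&: nbh x = [set a]) ->
  #|X| <= 1.
Proof.
move=> aS sAS iA cA Aa iX sXS pX.
have iAa : independent e (A :\ a) by exact: independent_sub (subsetDl _ _) iA.
have dAX : [disjoint X & A :\ a].
  apply/pred0P=> x; apply/negP=> /andP[/= /(subsetP sXS)].
  by rewrite !inE => /andP[/negbTE ->]; rewrite andbF.
have iXA : independent e (X :|: A :\ a).
  apply/independentP=> x y.
  have XA u w : u \in X -> w \in A :\ a -> ~~ adj u w.
    move=> Xu; rewrite !inE => /andP[wa Aw]; apply/negP=> auw.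
    by have /setP/(_ w) := pX _ Xu; rewrite !inE Aw auw (negbTE wa).
  move=> /setUP[] Hx /setUP[] Hy.
  - by move/independentP: iX; apply.
  - exact: XA.
  - by rewrite adjC XA.
  - by move/independentP: iAa; apply.
have := aS _ _ iXA; rewrite subUset (subset_trans sXS) ?subsetDl //=.
rewrite (subset_trans (subsetDl _ _) sAS) cardsU.
rewrite (disjoint_setI0 dAX) cards0 subn0; move=> /(_ isT); rewrite -cA (cardsD1 a A) Aa; lia.
Qed.

(** By maximality of [A], each vertex of [X] has a neighbour in [A]; those with only one contribute
    1 instead of 2, and there are at most 2k of them. *)
Lemma edges_max_indep_ge k S A X : alpha_le k S -> A \subset S ->
  independent e A -> #|A| = k -> X \subset S :\: A ->
  #|X|.*2 <= edges X A + k.*2.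
Proof.
move=> aS sAS iA cA sX.
pose P := [set x in X | #|A :&: nbh x| == 1].
have cP : #|P| <= k.*2.
  apply: (@leq_trans (edges A P)).
    rewrite edgesC -sum1_card; apply: leq_sum => x.
    by rewrite inE => /andP[_ /eqP->].
  rewrite -muln2 -cA -sum_nat_const; apply: leq_sum => a Aa.
  (* For each [a], the vertices attached only to [a] split into out- and in-neighbours of [a]. Both
     parts are independent, so each has at most one element. *)
  have pr (Z : {set T}) : Z \subset nbh a -> independent e Z -> #|P :&: Z| <= 1.
    move=> sZ iZ; apply: (@private_le1 k S A _ a) => //.
    - exact: independent_sub (subsetIr _ _) iZ.
    - apply/subsetP=> x; rewrite !inE => /andP[/andP[/(subsetP sX)]].
      by rewrite inE.
    - move=> x /setIP[]; rewrite inE => /andP[_ /cards1P[b pb]] /(subsetP sZ) ax.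
      have : a \in A :&: nbh x by rewrite !inE Aa; move: ax; rewrite !inE adjC.
      by rewrite pb inE => /eqP ->.
  rewrite nbhE setIUr cardsU (leq_trans (leq_subr _ _)) //.
  rewrite -[2]/(1 + 1) leq_add // pr //.
  - by rewrite nbhE subsetUl.
  - exact: onbh_indep.
  - by rewrite nbhE subsetUr.
  - exact: inbh_indep.
suff : #|X|.*2 <= edges X A + #|P| by lia.
rewrite -muln2 -sum_nat_const /edges.
have -> : #|P| = \sum_(x in X) (#|A :&: nbh x| == 1).
  rewrite -sum1_card big_mkcond [RHS]big_mkcond; apply: eq_bigr => x _.
  by rewrite inE; case: (x \in X); case: eqP.
rewrite -big_split; apply: leq_sum => x Xx /=.
have := nbh_max_indep aS sAS iA cA (subsetP sX _ Xx); case: eqP => /=; lia.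
Qed.

(** At k = 0, 1 the values 0 and 3 lie below the quadratic, which would give 2 and 4. *)
Definition l3_bound k := if k < 2 then 3 * k else k ^ 2 + k + 2.

Lemma card_alpha0 S : alpha_le 0 S -> #|S| = 0.
Proof.
move=> aS; apply/eqP; rewrite cards_eq0; apply/eqP/setP=> x; rewrite inE.
apply/negP=> Sx; have := aS [set x]; rewrite sub1set Sx cards1.
by move=> /(_ isT (@independent1 x)).
Qed.

(* The non-neighbours D of c in C form an 8-set without independent triples,
   so all degrees inside D are at least 4; every vertex of D has a neighbour
   in the maximum independent set P. Adding up, the degree sum exceeds 72. *)
Lemma no_14_vertices_degree_sum_72 (C P Q : {set T}) c :
  (forall S, alpha_le 1 S -> #|S| <= 3) ->
  alpha_le 3 C -> #|C| = 14 -> (forall y, y \in C -> 5 <= #|C :&: nbh y|) ->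
  edges C C <= 72 -> c \in C -> C :&: nbh c = P :|: Q -> [disjoint P & Q] ->
  independent e P -> independent e Q -> #|P| = 3 -> #|Q| = 2 -> False.
Proof.
move=> bd1 aC cC degC sC Cc NPQ dPQ iP iQ cP cQ.
pose D := C :\ c :\: nbh c.
have aD : alpha_le 2 D by exact: alpha_le_nonnbh.
have cPQ : #|P :|: Q| = 5.
  by rewrite cardsU (disjoint_setI0 dPQ) cards0 cP cQ.
have cD : #|D| = 8 by have := card_nbh_split Cc; rewrite NPQ cC cPQ /D; lia.
have degD y : y \in D -> 4 <= #|D :&: nbh y|.
  move=> Dy; have := bd1 _ (alpha_le_nonnbh Dy aD).
  have := card_nbh_split Dy; lia.
have sPQ : P :|: Q \subset C by rewrite -NPQ subsetIl.
have [sPC sQC] : P \subset C /\ Q \subset C by apply/andP; rewrite -subUset.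
have PQN y : y \in P :|: Q -> adj c y by rewrite -NPQ !inE => /andP[].
have cNPQ : c \notin P :|: Q by apply/negP=> /PQN; rewrite adjxx.
have dPD : [disjoint P :|: Q & D].
  apply/pred0P=> y; apply/negP=> /andP[/= /PQN acy].
  by rewrite !inE acy.
have dcD : [disjoint [set c] & (P :|: Q) :|: D].
  by rewrite disjoints1 inE negb_or cNPQ !inE eqxx andbF.
have defC : C = [set c] :|: ((P :|: Q) :|: D).
  apply/setP=> y; rewrite -NPQ !inE; case: eqP => [->|] //=.
  by case: (adj c y); rewrite ?andbT ?andbF ?orbF.
have ePD : 8 <= edges P D.
  rewrite edgesC; have := @edges_ge 1 D P; rewrite cD; apply => y Dy.
  apply: (nbh_max_indep aC) => //; rewrite !inE.
  move: Dy; rewrite !inE => /and3P[Ny _ ->]; rewrite andbT.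
  by apply: contra Ny => Py; apply: PQN; rewrite inE Py.
have eDD : 32 <= edges D D by have := @edges_ge 4 D D; rewrite cD; apply.
have eQC : 10 <= edges Q C.
  have := @edges_ge 5 Q C; rewrite cQ; apply => y Qy.
  by apply/degC/(subsetP sQC).
have ec : edges [set c] C = 5 by rewrite edges1l NPQ.
have eD0 : edges [set c] D = 0.
  rewrite edges1l; apply: eq_card0 => y.
  by rewrite !inE; case: (adj c y); rewrite ?andbF.
have ec' : edges [set c] P <= 3 /\ edges [set c] Q <= 2.
  by rewrite -cP -cQ !edges1l !subset_leq_card ?subsetIl.
have ecc : edges [set c] [set c] = 0.
  by apply: edges_indep; exact: independent1.
(* Pairs with [c] give 2 * 5, pairs between [P] and [D] at least 2 * 8, pairs of [Q] with [P] or [D]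
   at least 2 * (10 - 2), and pairs inside [D] at least 32: 74 in all. *)
move: sC eQC ec; rewrite defC !(edgesUl, edgesUr) //.
rewrite (edgesC D) (edgesC D P) (edgesC D Q) (edgesC Q P).
rewrite ?(edgesC _ [set c]) (edges_indep iP) (edges_indep iQ) ecc eD0.
case: ec' => ? ?; lia.
Qed.

(** The independence bound is [k.+1], so the exceptional case k = 4 of the overview is [k = 3]
    here. *)
Lemma l3_bound_step k S : 2 <= k ->
  (forall j X, j <= k -> alpha_le j X -> #|X| <= l3_bound j) ->
  alpha_le k.+1 S -> #|S| <= k.+1 ^ 2 + k.+1 + 2.
Proof.
move=> k2 IH aS; rewrite leqNgt; apply/negP=> cS.
have bk : l3_bound k = k ^ 2 + k + 2 by rewrite /l3_bound ltnNge k2.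
(* A counterexample has at least (k+1)^2 + (k+1) + 3 = 1 + 2(k+1) + (k^2 + k + 2) vertices, which
   forces equality in every bound. *)
have reg y : y \in S ->
    [/\ #|S :&: onbh y| = k.+1, #|S :&: inbh y| = k.+1,
        #|S :&: nbh y| = k.+1.*2 & #|S :\ y :\: nbh y| = l3_bound k].
  move=> Sy; have := IH _ _ (leqnn k) (alpha_le_nonnbh Sy aS).
  have := card_nbh_split Sy; have := card_nbh_le y aS.
  have := card_nbh_le2 S y; have := card_onbh_le y aS.
  have := card_inbh_le y aS; move: cS; rewrite bk expnS expn1 => *; split; nia.
have [x Sx] : exists x, x \in S.
  by apply/set0Pn; rewrite -card_gt0; apply: leq_trans cS.
have [cA cB cN] := reg x Sx.
set A := S :&: onbh x in cA *; set B := S :&: inbh x in cB *.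
set C := S :\ x :\: nbh x => cC; rewrite bk in cC.
have aC : alpha_le k C by exact: alpha_le_nonnbh.
have iA : independent e A.
  exact: independent_sub (subsetIr _ _) (onbh_indep x).
have iB : independent e B.
  exact: independent_sub (subsetIr _ _) (inbh_indep x).
have sCS : C \subset S.
  by rewrite /C; apply/subsetP=> y; rewrite !inE => /and3P[].
have sCA : C \subset S :\: A.
  apply/subsetP=> y; rewrite !inE /adj => /and3P[]; rewrite negb_or.
  by case/andP=> /negbTE -> _ _ ->; rewrite andbF.
have sCB : C \subset S :\: B.
  apply/subsetP=> y; rewrite !inE /adj => /and3P[]; rewrite negb_or.
  by case/andP=> _ /negbTE -> _ ->; rewrite andbF.
have eA : #|C|.*2 <= edges C A + k.+1.*2.
  exact: edges_max_indep_ge aS (subsetIl _ _) iA cA sCA.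
have eB : #|C|.*2 <= edges C B + k.+1.*2.
  exact: edges_max_indep_ge aS (subsetIl _ _) iB cB sCB.
(* Sizes k+1, k+1 and 2(k+1) for the union leave no overlap. *)
have dAB : [disjoint A & B].
  rewrite -setI_eq0 -cards_eq0; move: cN.
  by rewrite nbhE setIUr -/A -/B cardsU cA cB; lia.
have dABC : [disjoint A :|: B & C].
  apply/pred0P=> y; rewrite !inE -andb_orr /adj.
  by case: (_ || _); rewrite ?andbF.
have eCS : edges C C + edges C A + edges C B <= #|C| * k.+1.*2.
  rewrite -sum_nat_const /edges -!big_split /=; apply: leq_sum => c Cc.
  have [_ _ <- _] := reg _ (subsetP sCS _ Cc).
  have <- : #|(C :|: (A :|: B)) :&: nbh c| =
     #|C :&: nbh c| + #|A :&: nbh c| + #|B :&: nbh c|.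
    have E X : #|X :&: nbh c| = edges [set c] X by rewrite edges1l.
    by rewrite !E !edgesUr // ?addnA // disjoint_sym.
  by apply/subset_leq_card/setSI; rewrite !subUset sCS !subsetIl.
have degC c : c \in C -> #|C| <= (#|C :&: nbh c| + l3_bound k.-1).+1.
  move=> Cc; rewrite (card_nbh_split Cc) ltnS leq_add2l; apply: IH; first lia.
  by apply: alpha_le_nonnbh; rewrite ?prednK //; lia.
(* Now [edges C C] is at most (2k-2)|C| + 4(k+1). For k = 2 this is 28 < 8 * 4. For k > 3, minimum
   degree 2k-1 would give |C| <= 4k+4, but |C| = k^2 + k + 2. *)
case: (ltngtP k 3) => k3.
- have {k3} k3 : k = 2 by lia.
  rewrite {}k3 in cC eCS eA eB degC.
  have {}cC : #|C| = 8 := cC.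
  have : #|C| * 4 <= edges C C.
    by apply: edges_ge => c /degC; rewrite cC /l3_bound /=; lia.
  by rewrite cC in eCS eA eB *; lia.
- have : #|C| * (2 * k - 1) <= edges C C.
    apply: edges_ge => c /degC; rewrite cC /l3_bound ifF; last lia.
    case: (k) k3 => // j _; rewrite /= !expnS !expn0; nia.
  rewrite expnS expn1 in cC; nia.
- rewrite k3 in cC eCS eA eB degC aC IH.
  have {}cC : #|C| = 14 := cC.
  have {}degC c : c \in C -> 5 <= #|C :&: nbh c|.
    by move=> /degC; rewrite cC /l3_bound /=; lia.
  have sC : edges C C <= 72 by rewrite cC in eCS eA eB; lia.
  (* Degrees of 6 or more throughout would sum to at least 84 > 72. *)
  have [c Cc dc] : exists2 c, c \in C & #|C :&: nbh c| = 5.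
    have [/exists_inP[c Cc /eqP]|] :=
      boolP [exists c in C, #|C :&: nbh c| == 5]; first by exists c.
    rewrite negb_exists_in => /forall_inP H.
    have : #|C| * 6 <= edges C C.
      by apply: edges_ge => c Cc; move: (H c Cc) (degC c Cc) => /eqP; lia.
    by rewrite cC; lia.
  have := card_nbh_le2 C c; have := card_onbh_le c aC.
  have := card_inbh_le c aC.
  have io : independent e (C :&: onbh c).
    exact: independent_sub (subsetIr _ _) (onbh_indep c).
  have ii : independent e (C :&: inbh c).
    exact: independent_sub (subsetIr _ _) (inbh_indep c).
  have b1 X : alpha_le 1 X -> #|X| <= 3 by exact: (IH 1).
  have doi : [disjoint C :&: onbh c & C :&: inbh c].
    have [ho hi hn _] := reg _ (subsetP sCS _ Cc).
    have d : [disjoint S :&: onbh c & S :&: inbh c].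
      rewrite -setI_eq0 -cards_eq0; move: hn.
      by rewrite nbhE setIUr cardsU ho hi; lia.
    by apply: disjointWl (setSI _ sCS) _; apply: disjointWr (setSI _ sCS) d.
  have Noi : C :&: nbh c = C :&: onbh c :|: C :&: inbh c by rewrite nbhE setIUr.
  move=> hi ho ht.
  have hs : #|C :&: onbh c| + #|C :&: inbh c| = 5.
    by rewrite -dc Noi cardsU (disjoint_setI0 doi) cards0 subn0.
  (* Both parts have at most 3 elements and together 5, so they have sizes 3 and 2 in some order. *)
  have [o3|o2] : #|C :&: onbh c| = 3 \/ #|C :&: inbh c| = 3 by lia.
    by apply: (no_14_vertices_degree_sum_72 b1 aC cC degC sC Cc Noi) => //; lia.
  rewrite setUC in Noi; rewrite disjoint_sym in doi.
  by apply: (no_14_vertices_degree_sum_72 b1 aC cC degC sC Cc Noi) => //; lia.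
Qed.

Lemma card_alpha_l3 k S : alpha_le k S -> #|S| <= l3_bound k.
Proof.
elim/ltn_ind: k S => k IH S aS.
case: k aS IH => [|k] aS IH; first by rewrite card_alpha0.
have [k2|k2] := leqP 2 k.
  rewrite /l3_bound ltnNge (leqW k2); apply: l3_bound_step => // j X jk.
  exact: IH.
(* The plain splitting suffices for the bounds 1 + 2 + 0 = 3 and 1 + 4 + 3 = 8. *)
have [->|[x Sx]] := set_0Vmem S; first by rewrite cards0.
have := IH k (leqnn _) _ (alpha_le_nonnbh Sx aS).
rewrite (card_nbh_split Sx); have := card_nbh_le x aS.
by case: k k2 {IH aS} => [|[|]] //= _; rewrite /l3_bound /=; lia.
Qed.

End TriangleFree.
End Adjacency.

(** * Transitive tournaments and neighbourhoods *)

Section Ramsey.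
Variable T : finType.
Implicit Types (e : rel T) (S A X : {set T}).

Definition trans_le l e S :=
  forall A, A \subset S -> induces_transitive_tournament e A -> #|A| <= l.

Lemma oriented_asym e x y : oriented e -> e x y -> ~~ e y x.
Proof.
move=> [irr asy] exy; have xy : x != y.
  by apply: contraTneq exy => ->; exact: irr.
by have := asy _ _ xy; rewrite exy.
Qed.

Definition rev_rel e : rel T := fun x y => e y x.

Lemma oriented_rev e : oriented e -> oriented (rev_rel e).
Proof.
by move=> [irr asy]; split=> [x|x y xy]; rewrite /rev_rel ?irr // andbC asy.
Qed.

Lemma transitive_tournament_rev e A :
  induces_transitive_tournament e A ->
  induces_transitive_tournament (rev_rel e) A.
Proof.
move=> [tA rA]; split=> [x y Ax Ay xy|x y z Ax Ay Az exy eyz].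
  by rewrite /rev_rel addbC tA.
exact: rA eyz exy.
Qed.

(** The vertex [x] becomes the new source. *)
Lemma transitive_tournamentU1 e A x : oriented e -> A \subset onbh e x ->
  induces_transitive_tournament e A ->
  induces_transitive_tournament e (x |: A).
Proof.
move=> oe /subsetP sA [tA rA].
have xA y : y \in A -> e x y by move/sA; rewrite inE.
have Ax y : y \in A -> e y x = false.
  by move=> /xA /(oriented_asym oe) /negbTE.
have exx : e x x = false by apply/negbTE; case: oe.
split=> [y z|y z w].
  case/setU1P=> [->|Ay] /setU1P[->|Az] yz; first by rewrite eqxx in yz.
  - by rewrite xA // Ax.
  - by rewrite xA // Ax.
  - exact: tA.
case/setU1P=> [->|Ay] /setU1P[->|Az] /setU1P[->|Aw];
  rewrite ?exx ?Ax //; first by move=> _ _; exact: xA.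
exact: rA.
Qed.

Lemma trans_le_sub l e S X : X \subset S -> trans_le l e S -> trans_le l e X.
Proof. by move=> sXS tS A sAX; apply: tS; exact: subset_trans sXS. Qed.

Lemma trans_le_onbh l e S x : oriented e -> x \in S ->
  trans_le l.+1 e S -> trans_le l e (S :&: onbh e x).
Proof.
move=> oe Sx tS A; rewrite subsetI => /andP[sAS sAx] ttA.
have xA : x \notin A.
  by apply/negP=> /(subsetP sAx); rewrite inE; apply/negP; case: oe.
rewrite -ltnS -add1n -[1]/(true : nat) -xA -cardsU1; apply: tS.
  by rewrite subUset sub1set Sx.
exact: transitive_tournamentU1.
Qed.

(** Reversing all arcs keeps transitive tournaments and turns in-neighbours into out-neighbours. *)
Lemma trans_le_inbh l e S x : oriented e -> x \in S ->
  trans_le l.+1 e S -> trans_le l e (S :&: inbh e x).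
Proof.
move=> oe Sx tS A sA ttA.
have := @trans_le_onbh l (rev_rel e) S x (oriented_rev oe) Sx.
move=> /(_ _ A sA (transitive_tournament_rev ttA)); apply => X sX.
by move=> /transitive_tournament_rev; exact: tS.
Qed.

End Ramsey.

(** * Binomial recursions and the bound for all l *)

Definition ramsey_sum k l := \sum_(0 <= i < l) 'C(i + k, i.+1) * 2 ^ i.
(** The subtracted term of [v] for m = k+1, n = l+1. The test [k < 3] encodes the negative lower
    index m - 4, since truncated [k - 3] would give a binomial equal to 1. *)
Definition ramsey_gain k l :=
  if k < 3 then 0 else 'C(k + l - 4, k - 3) * 2 ^ (l - 2).

Lemma ramsey_sum0 l : ramsey_sum 0 l = 0.
Proof. by apply: big1 => i _; rewrite addn0 bin_small. Qed.

(** Pascal's rule splits the sum in two; in one half the first term is 1 and the rest, reindexed, is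
    twice the shorter sum. *)
Lemma ramsey_sum_rec k l :
  ramsey_sum k.+1 l.+1 = (2 * ramsey_sum k.+1 l + ramsey_sum k l.+1).+1.
Proof.
rewrite /ramsey_sum.
under eq_bigr do rewrite addnS binS mulnDl.
rewrite big_split /= addnC.
rewrite [X in X + _ = _]big_nat_recl // bin0 mul1n expn0 add1n addSn.
congr (_ + _).+1; rewrite big_distrr /=; apply: eq_bigr => i _.
by rewrite expnS addSn addnS; lia.
Qed.

Lemma ramsey_gain_rec k l : 2 <= l ->
  ramsey_gain k.+1 l.+1 = 2 * ramsey_gain k.+1 l + ramsey_gain k l.+1.
Proof.
case: l => [|[|l]] // _; rewrite /ramsey_gain.
have [k2|k3] := leqP k 1; first by rewrite !ifT; lia.
have [->|k3'] : k = 2 \/ 3 <= k by lia.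
  by rewrite /= !subSS !subn0 !bin0 !mul1n addn0 expnS.
have [j ->] : exists j, k = j + 3 by exists (k - 3); lia.
rewrite !ifF; try lia.
have -> : (j + 3).+1 + l.+3 - 4 = (j + l).+2.+1 by lia.
have -> : (j + 3).+1 + l.+2 - 4 = (j + l).+2 by lia.
have -> : j + 3 + l.+3 - 4 = (j + l).+2 by lia.
have -> : (j + 3).+1 - 3 = j.+1 by lia.
have -> : j + 3 - 3 = j by lia.
have -> : l.+3 - 2 = l.+1 by lia.
have -> : l.+2 - 2 = l by lia.
by rewrite binS mulnDl expnS; lia.
Qed.

(** The right side is k^2 + 2k, and the gain is k - 2 for k >= 3. *)
Lemma l3_bound_le_ramsey_sum k : l3_bound k + ramsey_gain k 2 <= ramsey_sum k 2.
Proof.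
rewrite /ramsey_sum !big_nat_recr //= big_geq // !add0n expn0 muln1 bin1 add1n.
rewrite bin2 expn1 muln2 /ramsey_gain /l3_bound.
have /= h : (k.+1 * k)./2.*2 = k.+1 * k.
  by rewrite -[RHS]odd_double_half oddM /= andNb add0n.
rewrite h; have [k3|k3] := ltnP k 3; first by case: k k3 {h} => [|[|[|]]].
rewrite ifF; last lia.
have -> : k + 2 - 4 = (k - 3).+1 by lia.
by rewrite binSn subnn expn0 muln1 expnS expn1; nia.
Qed.

(** Induction on l, then on k, splitting at a vertex. The additive form avoids truncated
    subtraction. *)
Lemma card_ramsey (T : finType) (e : rel T) k l (S : {set T}) :
  oriented e -> 2 <= l -> alpha_le e k S -> trans_le l e S -> #|S| + ramsey_gain k l <= ramsey_sum k l.
Proof.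
move=> oe; elim: l k S => [//|l IHl] + S l2.
have [irr _] := oe.
have [->|l2'] : l = 1 \/ 2 <= l by lia.
  move=> k aS tS; apply: leq_trans (l3_bound_le_ramsey_sum k); rewrite leq_add2r.
  (* Only [S] is known to contain no transitive triangle, so arcs are restricted to [S]. *)
  pose f : rel T := fun x y => [&& x \in S, y \in S & e x y].
  have firr x : ~~ f x x by rewrite /f (negbTE (irr x)) !andbF.
  apply: (@card_alpha_l3 _ f) => // [x y z|A sA iA].
    move=> /and3P[Sx Sy exy] /and3P[_ Sz eyz].
    apply/negP=> /and3P[_ _ exz].
    have tz : induces_transitive_tournament e [set z].
      by split=> [u w /set1P-> /set1P->|u w t /set1P-> /set1P-> /set1P->];
        rewrite ?eqxx.
    have tyz : induces_transitive_tournament e (y |: [set z]).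
      by apply: transitive_tournamentU1 => //; rewrite sub1set inE.
    have txyz : induces_transitive_tournament e (x |: (y |: [set z])).
      apply: transitive_tournamentU1 => //.
      by rewrite subUset !sub1set !inE exy.
    have n2 u w : e u w -> u == w = false.
      by move=> euw; apply: contraTF euw => /eqP->.
    have := tS _ _ txyz; rewrite !subUset !sub1set Sx Sy Sz => /(_ isT).
    by rewrite !cardsU1 cards1 !inE !n2.
  apply: aS => // x y Ax Ay; have := iA _ _ Ax Ay.
  by rewrite /f !(subsetP sA).
move=> k; elim: k S => [|k IHk] S aS tS.
  by rewrite (card_alpha0 irr aS) ramsey_sum0.
rewrite ramsey_sum_rec ramsey_gain_rec //.
(* With no vertex to split at, the induction hypotheses for the empty set still bound the gain by
   the sum. *)
have [S0|[x Sx]] := set_0Vmem S.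
  have a0 j : alpha_le e j set0.
    by move=> A; rewrite subset0 => /eqP-> _; rewrite cards0.
  have t0 j : trans_le j e set0.
    by move=> A; rewrite subset0 => /eqP-> _; rewrite cards0.
  have := IHk _ (a0 k) (t0 _); have := IHl _ _ l2' (a0 k.+1) (t0 _).
  by rewrite S0 cards0; lia.
rewrite (card_nbh_split irr Sx).
have sC : S :\ x :\: nbh e x \subset S.
  by apply/subsetP=> y; rewrite !inE => /and3P[].
have := IHk _ (alpha_le_nonnbh irr Sx aS) (trans_le_sub sC tS).
have := IHl _ _ l2' (alpha_le_sub (subsetIl _ _) aS) (trans_le_onbh oe Sx tS).
have := IHl _ _ l2' (alpha_le_sub (subsetIl _ _) aS) (trans_le_inbh oe Sx tS).
have := card_nbh_le2 e S x; lia.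
Qed.

(** This is the bound for the graph without vertices; it makes the natural-number subtraction below
    exact. *)
Lemma ramsey_gain_le_sum k l : 2 <= l -> ramsey_gain k l <= ramsey_sum k l.
Proof.
move=> l2; have o : oriented (fun _ _ : void => false) by split=> [[]|[]].
rewrite -[ramsey_gain k l]add0n -(cards0 void); apply: (card_ramsey o) => // A.
  by rewrite subset0 => /eqP-> _; rewrite cards0.
by rewrite subset0 => /eqP-> _; rewrite cards0.
Qed.

(** * Identification with [v] and the Ramsey number *)

Lemma v_ramsey_sum k l : 0 < k -> 2 <= l ->
  v k.+1 l.+1 = Posz (ramsey_sum k l - ramsey_gain k l).+1.
Proof.
move=> k0 l2; rewrite -[X in Posz X]addn1 PoszD -subzn ?ramsey_gain_le_sum // /v.
congr (_ - _ + _)%R.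
  rewrite /ramsey_sum (big_morph Posz PoszD (erefl _)); apply: eq_bigr => i _.
  have -> : (i%:Z + k.+1%:Z - 1)%R = Posz (i + k) by lia.
  have -> : (i%:Z + 1)%R = Posz i.+1 by lia.
  by rewrite PoszM -[Posz (2 ^ _)]natz natrX.
rewrite /ramsey_gain; have [k3|k3] := ltnP k 3.
  have -> : (k.+1%:Z - 4)%R = Negz (2 - k) by lia.
  by rewrite mul0r.
have -> : (k.+1%:Z + l.+1%:Z - 6)%R = Posz (k + l - 4) by lia.
have -> : (k.+1%:Z - 4)%R = Posz (k - 3) by lia.
by rewrite subSS PoszM -[Posz (2 ^ _)]natz natrX.
Qed.

Lemma exists_subset_card (T : finType) (A : {set T}) n :
  n <= #|A| -> exists2 B : {set T}, B \subset A & #|B| = n.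
Proof.
elim: n => [|n IHn] nA; first by exists set0; rewrite ?sub0set ?cards0.
have [B sBA cB] := IHn (ltnW nA).
have [x /setDP[Ax xB]] : exists x, x \in A :\: B.
  by apply/set0Pn; rewrite -card_gt0 cardsD (setIidPr sBA) cB subn_gt0.
exists (x |: B); first by rewrite subUset sub1set Ax.
by rewrite cardsU1 xB cB.
Qed.

Lemma ramsey_property_ramsey_sum k l : 2 <= l ->
  ramsey_property k.+1 l.+1 (ramsey_sum k l - ramsey_gain k l).+1.
Proof.
move=> l2 T e cT oe; apply: NNPP => /not_or_and[nI nL].
have : #|[set: T]| + ramsey_gain k l <= ramsey_sum k l.
  apply: (card_ramsey oe) => // A _ iA; rewrite leqNgt; apply/negP.
    move=> /exists_subset_card[B sBA cB]; apply: nI; exists B; split=> //.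
    exact: independent_sub iA.
  move=> /exists_subset_card[B sBA cB]; apply: nL; exists B; split=> //.
  have /subsetP s := sBA; case: iA => tA rA; split.
    by move=> x y /s Ax /s Ay; exact: tA.
  by move=> x y z /s Ax /s Ay /s Az; exact: rA.
by rewrite cardsT cT; have := ramsey_gain_le_sum k l2; lia.
Qed.

(** Passes from one order with the Ramsey property to the Ramsey number; classical logic replaces
    decidability of [P]. *)
Lemma least_nat (P : nat -> Prop) n : P n ->
  exists r, [/\ P r, r <= n & forall k, P k -> r <= k].
Proof.
elim/ltn_ind: n => n IH Pn.
have [[k kn Pk]|H] := classic (exists2 k, k < n & P k).
  by have [r [Pr rk Hr]] := IH k kn Pk; exists r; split=> //; lia.
exists n; split=> // k Pk; rewrite leqNgt; apply/negP=> kn.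
by apply: H; exists k.
Qed.

Local Open Scope ring_scope.

Theorem mainTheorem13 (m n : nat) (hm : (2 <= m)%N) (hn : (3 <= n)%N) :
  exists r : nat, is_ramsey_number m n r /\ r%:Z <= v m n.
Proof.
case: m hm => [//|k] k0; case: n hn => [//|l] l2.
have [r [Pr rv Hr]] := least_nat (@ramsey_property_ramsey_sum k l l2).
by exists r; split; [split | rewrite v_ramsey_sum].
Qed.
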